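(* Let $R\geq 4$, let $q'\geq 3$ be a prime power and let $q=(q')^{R}$. Put $$n^{(1)}_{R,q}=(\sqrt[R]{q}-1)\left(\frac{R(R+1)}{2}-2\right)+R+5,$$ and let $t_0$ be an integer with $q^{t_0-1}\geq n^{(1)}_{R,q}$. Then for every codimension $r=Rt+1$ with $t=1$ or $t\geq t_0$ there exists a linear $[n,n-r]_q$ code with covering radius $R$ and length $$n=n^{(1)}_{R,q}\cdot q^{\frac{r-(R+1)}{R}}+\begin{cases}0 & \text{if } q'\geq 4,\\[2pt] w\,\dfrac{q^{\frac{r-(R+1)}{R}}-1}{q-1}\ \text{ for some } w\in\{0,1\} & \text{if } q'=3.\end{cases}$$
   Context: For a prime power $q$, an $[n,n-r]_q$ code is a linear subspace of $F_q^n$ of dimension $n-r$ (codimension $r$). It has covering radius $R$ if every column of $F_q^{r}$ is a linear combination of at most $R$ columns of a parity-check matrix of the code, and $R$ is the smallest integer with this property (equivalently, the spheres of radius $R$ around codewords cover $F_q^n$). *)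

(* Defs.v *)
From HB Require Import structures.
From mathcomp Require Import all_boot all_order all_algebra.
Set Implicit Arguments.
Unset Strict Implicit.
Unset Printing Implicit Defensive.
Import GRing.Theory.
Local Open Scope ring_scope.

Definition prime_power (q : nat) : Prop :=
  exists p k : nat, [/\ prime p, (0 < k)%N & q = (p ^ k)%N].

Section Codes.
Variable F : fieldType.

(* An [n, n - r] code over F. The bound [r <= n] rules out truncation of the
   subtraction. *)
Definition linear_code (n r : nat) (C : {vspace 'rV[F]_n}) : Prop :=
  (r <= n)%N /\ \dim C = (n - r)%N.

(* Full row rank forces [r] to be the codimension of [C]. *)
Definition parity_check_matrix (n r : nat) (H : 'M[F]_(r, n))
    (C : {vspace 'rV[F]_n}) : Prop :=
  row_free H /\ forall x : 'rV[F]_n, (x \in C) = (H *m x^T == 0).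

Definition covered_by_columns (n r : nat) (H : 'M[F]_(r, n)) (R : nat) : Prop :=
  forall s : 'cV[F]_r, exists (J : {set 'I_n}) (a : 'I_n -> F),
    (#|J| <= R)%N /\ s = \sum_(j in J) a j *: col j H.

(* The choice of the parity-check matrix is immaterial: two of them differ by
   an invertible matrix on the left. *)
Definition has_covering_radius (n : nat) (C : {vspace 'rV[F]_n})
    (R : nat) : Prop :=
  exists (r : nat) (H : 'M[F]_(r, n)),
    [/\ parity_check_matrix H C,
        covered_by_columns H R
      & forall R' : nat, covered_by_columns H R' -> (R <= R')%N].

End Codes.

(* The length n^(1)_{R,q} for q = q' ^ R, so that q' is the R-th root of q;
   no subtraction truncates when 1 <= q' and 2 <= R, and the division by 2 is
   exact. *)
Definition n1 (R q' : nat) : nat :=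
  ((q' - 1) * ((R * (R + 1)) %/ 2 - 2) + R + 5)%N.

(* Main.v *)
Require Import Defs.
From HB Require Import structures.
From mathcomp Require Import all_boot all_order all_algebra finfield ring zify.
Import Order.TTheory GRing.Theory Num.Theory.
Set Implicit Arguments.
Unset Strict Implicit.
Unset Printing Implicit Defensive.
Local Open Scope ring_scope.

(* Let K be the subfield of order q' of F. Every u in F^(R+1) is orthogonal to a
   nonzero vector over K, since F has dimension R over K; so u is an F-combination
   of at most R points of any point set over K whose trace on each hyperplane spans
   it. Such a set is: four pairwise skew lines of PG(3,K) without a common
   transversal, R - 3 further vertices, and the points joining each vertex to the
   later coordinate points. For this set u even is a combination of exactly R
   points with nonzero coefficients. As the length n1 does not exceed q, the points h
   can be labelled by distinct elements b_h of F, and the columns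
   (h, x, b_h x, ..., b_h^(R-1) x), with x in F^(t-1), then solve the problem in
   codimension R t + 1 by inverting a Vandermonde matrix. Fewer than R columns do not
   suffice: the coordinates of such a combination span at most R - 1 dimensions
   over K. *)

(** * Subfields of a finite field as fixed points of a Frobenius power *)

(* The unused characteristic proof makes the closure instance below inferable from the
   predicate. *)
Definition frob_fixed (F : fieldType) (p k : nat) (_ : p \in [pchar F]) : {pred F} :=
  fun x => x ^+ (p ^ k) == x.

Lemma frob_fixed_divring_closed (F : fieldType) (p k : nat) (chF : p \in [pchar F]) :
  divring_closed (frob_fixed k chF).
Proof.
have nF : [pchar F].-nat (p ^ k)%N.
  by rewrite pnatX pnatE ?chF // (pcharf_prime chF).
split=> [|x y /eqP Dx /eqP Dy|x y /eqP Dx /eqP Dy]; rewrite unfold_in.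
- by rewrite expr1n.
- by rewrite exprDn_pchar // exprNn_pchar // Dx Dy.
- by rewrite exprMn exprVn Dx Dy.
Qed.

Section FrobFixed.

Variables (F : finFieldType) (p k : nat) (chF : p \in [pchar F]).

HB.instance Definition _ := GRing.isDivringClosed.Build F (frob_fixed k chF)
  (frob_fixed_divring_closed k chF).

Record frob_subfield := FrobSubfield {
  frob_val : F; frob_valP : frob_val \in frob_fixed k chF }.

HB.instance Definition _ := [isSub for frob_val].
HB.instance Definition _ := [Finite of frob_subfield by <:].
HB.instance Definition _ :=
  [SubChoice_isSubIntegralDomain of frob_subfield by <:].
HB.instance Definition _ :=
  [SubIntegralDomain_isSubField of frob_subfield by <:].

(** The elements are the roots in [F] of ['X^Q - 'X], which divides ['X^#|F| - 'X], the product of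
    all ['X - x%:P]; hence there are [Q] distinct ones. *)
Lemma card_frob_subfield (n : nat) :
  (0 < k)%N -> #|F| = ((p ^ k) ^ n)%N -> #|{: frob_subfield}| = (p ^ k)%N.
Proof.
move=> k_gt0; set Q := (p ^ k)%N => oF.
have Q_gt1 : (1 < Q)%N by rewrite -(exp1n k) ltn_exp2r // prime_gt1 ?(pcharf_prime chF).
have sizeQ : size ('X^Q - 'X : {poly F}) = Q.+1.
  by rewrite size_polyDl size_polyXn // size_polyN size_polyX ltnS.
have nQ : [pchar {poly F}].-nat Q.
  by rewrite pnatX pnatE ?(pcharf_prime chF) // pchar_poly chF.
have dvdQ : ('X^Q - 'X : {poly F}) %| \prod_x ('X - x%:P).
  rewrite -finField_genPoly oF; elim: n {oF} => [|n IHn].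
    by rewrite expr1 subrr dvdp0.
  have -> : 'X^(Q ^ n.+1) - 'X = ('X^(Q ^ n) - 'X) ^+ Q + ('X^Q - 'X) :> {poly F}.
    by rewrite exprDn_pchar // exprNn_pchar // -exprM -expnSr addrA subrK.
  rewrite dvdp_add ?dvdpp // (dvdp_trans IHn) //.
  by case: (Q) (ltnW Q_gt1) => // Q' _; rewrite exprS dvdp_mulr.
have [m eqQ] := dvdp_prod_XsubC dvdQ.
set r := mask m _ in eqQ.
have r_uniq : uniq r by rewrite mask_uniq // index_enum_uniq.
have r_root x : (x \in r) = (x ^+ Q == x).
  have := eqp_root eqQ x; rewrite root_prod_XsubC => <-.
  by rewrite rootE !hornerE subr_eq0.
have size_r : size r = Q.
  by apply: succn_inj; rewrite -sizeQ (eqp_size eqQ) size_prod_XsubC.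
rewrite card_sub -size_r -(card_uniqP r_uniq).
by apply: eq_card => x; rewrite r_root.
Qed.

End FrobFixed.

Lemma subfield_exists (F : finFieldType) (Q n : nat) :
    prime_power Q -> #|F| = (Q ^ n)%N ->
  exists (K : finFieldType) (iota : {rmorphism K -> F}), #|K| = Q.
Proof.
move=> [p [k [p_pr k_gt0 ->]]] oF.
have chF : p \in [pchar F] by apply: (@card_finPcharP F p (k * n)); rewrite ?expnM.
exists (frob_subfield k chF), (val : {rmorphism frob_subfield k chF -> F}).
exact: card_frob_subfield oF.
Qed.

(** * Combinations with a prescribed number of nonzero coefficients *)

Section ExactCombination.

Variable F : fieldType.

(* Linear combinations of exactly [m] members of [c], all with nonzero coefficients.
   Members with distinct indices count as distinct even if they are equal vectors. *)
Definition exact_comb (V : lmodType F) (J : finType) (c : J -> V) (m : nat)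
    (u : V) : Prop :=
  exists2 a : J -> F, #|[set j | a j != 0]| = m & u = \sum_j a j *: c j.

Lemma exact_comb0 (V : lmodType F) (J : finType) (c : J -> V) : exact_comb c 0 0.
Proof.
exists (fun=> 0); last by rewrite big1 // => j _; rewrite scale0r.
by apply: eq_card0 => j; rewrite !inE eqxx.
Qed.

Lemma exact_comb1 (V : lmodType F) (J : finType) (c : J -> V) (j : J) (a : F) :
  a != 0 -> exact_comb c 1 (a *: c j).
Proof.
move=> a_neq0; exists (fun i => if i == j then a else 0).
  rewrite -[RHS](cards1 j); congr #|pred_of_set _|; apply/setP=> i.
  by rewrite !inE; case: (i == j); rewrite ?eqxx.
rewrite (bigD1 j) //= eqxx big1 ?addr0 // => i /negPf->.
by rewrite scale0r.
Qed.

Lemma exact_comb_inj (V : lmodType F) (I J : finType) (c : J -> V) (h : I -> J)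
    (m : nat) (u : V) :
  injective h -> exact_comb (c \o h) m u -> exact_comb c m u.
Proof.
(* A fibre of [h] has at most one element, so these sums extend [a] by zero outside the image. *)
move=> h_inj [a Da ->]; pose b j := \sum_(i | h i == j) a i.
have bh i : b (h i) = a i.
  by rewrite /b (eq_bigl (pred1 i)) ?big_pred1_eq // => k; rewrite (inj_eq h_inj).
exists b.
  rewrite -Da -(card_imset _ h_inj); congr #|pred_of_set _|; apply/setP=> j.
  apply/idP/imsetP => [|[i]]; rewrite !inE; last by move=> ai ->; rewrite bh.
  case: (pickP (fun i => h i == j)) => [i /eqP <-|no_i].
    by rewrite bh; exists i; rewrite ?inE.
  by rewrite /b big_pred0 ?eqxx.
rewrite (partition_big h predT) //=; apply: eq_bigr => j _.
by rewrite scaler_suml; apply: eq_bigr => i /eqP <-.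
Qed.

Lemma exact_comb_sum (V : lmodType F) (I J : finType) (c : I + J -> V)
    (m n : nat) (u v : V) :
    exact_comb (c \o inl) m u -> exact_comb (c \o inr) n v ->
  exact_comb c (m + n) (u + v).
Proof.
move=> [a Da ->] [b Db ->]; exists (fun k => match k with inl i => a i | inr j => b j end).
  by rewrite -Da -Db -!sum1dep_card big_sumType.
by rewrite big_sumType.
Qed.

Lemma exact_comb_map (V W : lmodType F) (g : {linear V -> W}) (J : finType)
    (c : J -> V) (m : nat) (u : V) :
  exact_comb c m u -> exact_comb (g \o c) m (g u).
Proof.
move=> [a Da ->]; exists a => //.
by rewrite linear_sum; apply: eq_bigr => j _; rewrite linearZ.
Qed.

Lemma exact_comb_ext (V : lmodType F) (J : finType) (c d : J -> V) (m : nat) (u : V) :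
  c =1 d -> exact_comb c m u -> exact_comb d m u.
Proof.
by move=> cd [a Da ->]; exists a => //; apply: eq_bigr => j _; rewrite cd.
Qed.

Lemma exact_comb2 (V : lmodType F) (J : finType) (c : J -> V) (i j : J) (a b : F) :
  i != j -> a != 0 -> b != 0 -> exact_comb c 2 (a *: c i + b *: c j).
Proof.
move=> ij a_neq0 b_neq0.
pose h (k : unit + unit) := if k is inl _ then i else j.
apply: (@exact_comb_inj _ _ _ _ h).
  by move=> [[]|[]] [[]|[]] //= E; rewrite E eqxx in ij.
apply: (@exact_comb_sum _ _ _ _ 1 1).
  exact: (@exact_comb1 _ _ (fun=> c i) tt).
exact: (@exact_comb1 _ _ (fun=> c j) tt).
Qed.

Lemma exact_comb_option (V : lmodType F) (J : finType) (c : option J -> V)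
    (m : nat) (u : V) (a : F) :
    a != 0 -> exact_comb (c \o some) m u ->
  exact_comb c m.+1 (a *: c None + u).
Proof.
move=> a_neq0 cu; pose h (k : unit + J) := if k is inr j then Some j else None.
apply: (@exact_comb_inj _ _ _ _ h); first by move=> [[]|j] [[]|k] //= [->].
apply: (@exact_comb_sum _ _ _ _ 1 m) => //.
exact: (@exact_comb1 _ _ (fun=> c None) tt).
Qed.

End ExactCombination.

Lemma exists_notin (T : finType) (s : seq T) :
  (size s < #|T|)%N -> exists x, x \notin s.
Proof.
move=> lt_s; apply/existsP; rewrite -negb_forall; apply: contraL lt_s => /forallP s_full.
rewrite -leqNgt (leq_trans _ (card_size s)) // subset_leq_card //.
by apply/subsetP=> x _; apply: s_full.
Qed.

(** * Orthogonality in dimension two and a matrix without eigenvectors *)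

Definition rv2 (R : Type) (a b : R) : 'rV[R]_2 := \row_i (if i == 0 then a else b).

Lemma rv2_eta (R : Type) (x : 'rV[R]_2) : x = rv2 (x 0 0) (x 0 1).
Proof.
by apply/rowP => -[[|[|//]] lt_i]; rewrite mxE; congr (x _ _); apply: val_inj.
Qed.

Lemma map_rv2 (R S : Type) (f : R -> S) (a b : R) :
  map_mx f (rv2 a b) = rv2 (f a) (f b).
Proof. by apply/rowP=> i; rewrite !mxE; case: ifP. Qed.

Lemma scale_rv2 (R : nzRingType) (k a b : R) : k *: rv2 a b = rv2 (k * a) (k * b).
Proof. by apply/rowP=> i; rewrite !mxE; case: ifP. Qed.

Lemma add_rv2 (R : nmodType) (a b c d : R) : rv2 a b + rv2 c d = rv2 (a + c) (b + d).
Proof. by apply/rowP=> i; rewrite !mxE; case: ifP. Qed.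

Lemma rv2_eq0 (R : nmodType) (a b : R) : (rv2 a b == 0) = (a == 0) && (b == 0).
Proof.
apply/eqP/andP => [/rowP e|[/eqP-> /eqP->]]; last first.
  by apply/rowP=> i; rewrite !mxE if_same.
by have := e 0; have := e 1; rewrite !mxE /= => -> ->.
Qed.

Lemma cv2P (R : Type) (g h : 'cV[R]_2) : g 0 0 = h 0 0 -> g 1 0 = h 1 0 -> g = h.
Proof.
move=> gh0 gh1; apply/matrixP=> -[[|[|//]] lt_i] j; rewrite ord1.
  by rewrite (_ : Ordinal lt_i = 0) //; apply: val_inj.
by rewrite (_ : Ordinal lt_i = 1) //; apply: val_inj.
Qed.

(* A row vector spanning the line orthogonal to [g] (see [perpP]). *)
Definition perp (R : nzRingType) (g : 'cV[R]_2) : 'rV[R]_2 := rv2 (g 1 0) (- g 0 0).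

Lemma mul_rv2 (R : nzRingType) (x : 'rV[R]_2) (g : 'cV[R]_2) :
  x *m g = (x 0 0 * g 0 0 + x 0 1 * g 1 0)%:M.
Proof.
rewrite [LHS]mx11_scalar mxE !big_ord_recl big_ord0 addr0.
by congr (_ * _ + x _ _ * g _ _)%:M; apply: val_inj.
Qed.

Lemma perp_mul (R : comNzRingType) (g : 'cV[R]_2) : perp g *m g = 0.
Proof. by rewrite mul_rv2 !mxE /= mulrC mulNr subrr raddf0. Qed.

Lemma perpD (R : nzRingType) (g h : 'cV[R]_2) : perp (g + h) = perp g + perp h.
Proof. by rewrite add_rv2 /perp !mxE opprD. Qed.

Lemma perp_neq0 (R : nzRingType) (g : 'cV[R]_2) : g != 0 -> perp g != 0.
Proof.
apply: contraNneq => /eqP; rewrite rv2_eq0 oppr_eq0 => /andP[/eqP g1 /eqP g0].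
by apply/eqP/cv2P; rewrite mxE.
Qed.

Lemma perpP (R : fieldType) (x : 'rV[R]_2) (g : 'cV[R]_2) :
  g != 0 -> x *m g = 0 -> exists a, x = a *: perp g.
Proof.
move=> /perp_neq0; rewrite rv2_eq0 oppr_eq0 negb_and mul_rv2 => g_neq0 xg.
have {}xg : x 0 0 * g 0 0 + x 0 1 * g 1 0 = 0.
  by have /matrixP/(_ 0 0) := xg; rewrite !mxE.
have [g1|g1_neq0] := eqVneq (g 1 0) 0.
  rewrite g1 eqxx /= in g_neq0; exists (- x 0 1 / g 0 0).
  rewrite [LHS]rv2_eta scale_rv2 g1 mulr0 mulrN mulfVK // opprK; congr rv2.
  move/eqP: xg; rewrite g1 mulr0 addr0 mulf_eq0 (negPf g_neq0) orbF.
  by move/eqP.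
exists (x 0 0 / g 1 0); rewrite [LHS]rv2_eta scale_rv2 mulfVK //; congr rv2.
apply: (mulIf g1_neq0); rewrite mulrN mulNr mulrAC mulfVK //.
by apply/eqP; rewrite -addr_eq0 addrC xg.
Qed.

Lemma mx11_scale (R : fieldType) (A B : 'M[R]_1) : B != 0 -> exists a, A = a *: B.
Proof.
move=> B_neq0; exists (A 0 0 / B 0 0); apply/matrixP=> i j; rewrite !ord1 mxE mulfVK //.
by apply: contraNneq B_neq0 => B0; rewrite [B]mx11_scalar B0 raddf0.
Qed.

(* M is the companion matrix of X^2 - X - b with b outside the image of y^2 - y, which
   is not onto as it takes the same value at 0 and 1. *)
Lemma exists_no_eigenvector (K : finFieldType) :
  exists M : 'M[K]_2, forall h : 'cV_2, h != 0 -> perp (M *m h) *m h != 0.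
Proof.
pose f y : K := y ^+ 2 - y.
have /existsP[b /forallP b_notin] : [exists b, [forall y, f y != b]].
  apply/contraT; rewrite negb_exists => /forallP surj.
  have fT : f @: [set: K] = [set: K].
    apply/eqP; rewrite eqEsubset subsetT; apply/subsetP=> b _.
    have := surj b; rewrite negb_forall => /existsP[y /negPn/eqP <-].
    exact: imset_f.
  have /imset_injP/(_ 0 1) : #|f @: [set: K]| == #|[set: K]| by rewrite fT.
  rewrite !inE /f expr0n expr1n subr0 subrr => /(_ isT isT erefl) /eqP.
  by rewrite eq_sym oner_eq0.
exists (\matrix_(i, j) if i == 0 then if j == 0 then 0 else b else 1) => h h_neq0.
have -> : forall g, perp g *m h = (g 1 0 * h 0 0 - g 0 0 * h 1 0)%:M.
  by move=> g; rewrite mul_rv2 !mxE mulNr.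
rewrite !mxE !big_ord_recl !big_ord0 !mxE /=.
have -> : lift 0 0 = 1 :> 'I_2 by apply: val_inj.
rewrite !mul1r mul0r add0r !addr0.
apply/eqP=> /matrixP/(_ 0 0); rewrite !mxE /= mulr1n => E.
have [h1|h1_neq0] := eqVneq (h 1 0) 0.
  have h0 : h 0 0 = 0.
    by move/eqP: E; rewrite h1 addr0 !mulr0 subr0 mulf_eq0 orbb => /eqP.
  by case/eqP: h_neq0; apply: cv2P; rewrite mxE.
(* [E] reads h0^2 + h0 h1 = b h1^2, so y = - h0 / h1 would solve y^2 - y = b. *)
have /eqP[] := b_notin (- h 0 0 / h 1 0).
apply/eqP; rewrite -subr_eq0; apply/eqP.
apply: (mulIf (expf_neq0 2 h1_neq0)); rewrite mul0r -[RHS]E /f; by field.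
Qed.

(** * Combinations of one, two or three points of a line over K *)

Section Line.

Variables (F K : finFieldType) (iota : {rmorphism K -> F}).
Hypotheses (K_gt2 : (2 < #|K|)%N) (F_gt3 : (3 < #|F|)%N).

(** Normalized representatives of the points of PG(1, K), with [None] the point at infinity. *)
Definition pt (o : option K) : 'rV[K]_2 := if o is Some c then rv2 1 c else rv2 0 1.

Local Notation line := (exact_comb (fun o => map_mx iota (pt o))).

Lemma line_comb1 (p : 'rV[K]_2) (a : F) :
  p != 0 -> a != 0 -> line 1 (a *: map_mx iota p).
Proof.
rewrite [p]rv2_eta; set x := p 0 0; set y := p 0 1; rewrite rv2_eq0 => p_neq0 a_neq0.
have [x0|x_neq0] := eqVneq x 0.
  rewrite x0 eqxx /= in p_neq0.
  have -> : a *: map_mx iota (rv2 x y) = (a * iota y) *: map_mx iota (pt None).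
    by rewrite x0 !map_rv2 !scale_rv2 rmorph0 rmorph1 !mulr0 mulr1.
  by apply: exact_comb1; rewrite mulf_neq0 ?fmorph_eq0.
have -> : a *: map_mx iota (rv2 x y) = (a * iota x) *: map_mx iota (pt (Some (y / x))).
  rewrite !map_rv2 !scale_rv2 rmorph1 mulr1 -mulrA -rmorphM.
  by rewrite [x * _]mulrC mulfVK.
by apply: exact_comb1; rewrite mulf_neq0 ?fmorph_eq0.
Qed.

(** In the basis (1, c), (1, d) a coefficient of [x] vanishes only if [x] is proportional to a basis
    vector, and at most one affine point is proportional to [x]. Three elements of K leave two good
    ones. *)
Lemma affine_comb2 (x : 'rV[F]_2) :
  x != 0 -> exact_comb (fun c => map_mx iota (pt (Some c))) 2 x.
Proof.
rewrite [x]rv2_eta; set s := x 0 0; set t := x 0 1; rewrite rv2_eq0 => x_neq0.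
have [b good_b] : exists b, forall c, c != b -> t - iota c * s != 0.
  case: (pickP (fun c => t - iota c * s == 0)) => [b /eqP bad_b|no_bad]; last first.
    by exists 0 => c _; rewrite no_bad.
  exists b => c; apply: contraNneq => /eqP.
  rewrite (subr0_eq bad_b) -mulrBl -rmorphB mulf_eq0 fmorph_eq0 subr_eq0 eq_sym.
  case/orP=> // /eqP s0; move: x_neq0.
  by rewrite (subr0_eq bad_b) s0 mulr0 eqxx.
have [c] := @exists_notin _ [:: b] (ltnW K_gt2).
have [d] := @exists_notin _ [:: b; c] K_gt2.
rewrite !inE negb_or => /andP[db dc] cb.
have cd_neq0 : iota c - iota d != 0.
  by rewrite -rmorphB fmorph_eq0 subr_eq0 eq_sym.
have -> : rv2 s t = ((t - iota d * s) / (iota c - iota d)) *: map_mx iota (pt (Some c))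
     + (- (t - iota c * s) / (iota c - iota d)) *: map_mx iota (pt (Some d)).
  rewrite !map_rv2 !scale_rv2 add_rv2 rmorph1 !mulr1; congr rv2; by field.
apply: (@exact_comb2 _ _ _ (fun c => map_mx iota (pt (Some c)))); first by rewrite eq_sym.
  by rewrite mulf_neq0 ?invr_eq0 ?good_b.
by rewrite mulf_neq0 ?invr_eq0 ?oppr_eq0 ?good_b.
Qed.

Lemma line_comb2 (x : 'rV[F]_2) : x != 0 -> line 2 x.
Proof. 
move/affine_comb2; apply: (@exact_comb_inj _ _ _ _ (fun o => map_mx iota (pt o)) Some).
by move=> c d []. Qed.

(** The point at infinity takes a coefficient that leaves a nonzero vector, even for [x = 0], to two
    affine points. *)
Lemma line_comb3 (x : 'rV[F]_2) : line 3 x.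
Proof.
have [|y] := @exists_notin _ [:: 0; x 0 1]; first exact: ltnW F_gt3.
rewrite !inE negb_or => /andP[y_neq0 y_neq].
have -> : x = y *: map_mx iota (pt None) + rv2 (x 0 0) (x 0 1 - y).
  rewrite map_rv2 scale_rv2 add_rv2 rmorph0 rmorph1 mulr0 mulr1 add0r addrC subrK.
  exact: rv2_eta.
apply: (@exact_comb_option _ _ _ (fun o => map_mx iota (pt o))) => //.
by apply: affine_comb2; rewrite rv2_eq0 subr_eq0 [x 0 1 == _]eq_sym (negPf y_neq) andbF.
Qed.

End Line.

(** * Four pairwise skew lines of PG(3, K) without a common transversal *)

Lemma perp_mulC (R : comNzRingType) (g h : 'cV[R]_2) : perp h *m g = - (perp g *m h).
Proof. by rewrite !mul_rv2 -raddfN !mxE /=; congr _%:M; ring. Qed.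

Lemma perp_par (R : fieldType) (g h : 'cV[R]_2) :
  g != 0 -> perp g *m h = 0 -> exists a, h = a *: g.
Proof.
move=> g_neq0 gh; have [|a] := @perpP _ (perp h) g g_neq0.
  by rewrite perp_mulC gh oppr0.
rewrite scale_rv2 => /rowP e; exists a.
have := e 0; have := e 1; rewrite !mxE /= mulrN => /oppr_inj h0 h1.
by apply: cv2P; rewrite mxE.
Qed.

Section FourLines.

Variables (F K : finFieldType) (iota : {rmorphism K -> F}).
Hypotheses (K_gt2 : (2 < #|K|)%N) (F_gt3 : (3 < #|F|)%N).
Variable M : 'M[K]_2.
Hypothesis M_no_eig : forall h : 'cV_2, h != 0 -> perp (M *m h) *m h != 0.

Local Notation line := (exact_comb (fun o => map_mx iota (pt o))).

(* The lines (x, 0), (0, x), (x, x) lie in a regulus; the line (x, x M) meets no line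
   of the opposite regulus because M has no eigenvector over K. *)
Definition quad_pt (k : (option K + option K) + (option K + option K)) : 'rV[K]_(2 + 2) :=
  match k with
  | inl (inl o) => pt o *m row_mx 1%:M 0
  | inl (inr o) => pt o *m row_mx 0 1%:M
  | inr (inl o) => pt o *m row_mx 1%:M 1%:M
  | inr (inr o) => pt o *m row_mx 1%:M M
  end.

Local Notation quad := (exact_comb (fun k => map_mx iota (quad_pt k))).

Lemma line_map (n : nat) (E : 'M[K]_(2, n)) (m : nat) (x : 'rV[F]_2) :
  line m x -> exact_comb (fun o => map_mx iota (pt o *m E)) m (x *m map_mx iota E).
Proof.
move=> /(@exact_comb_map _ _ _ (mulmxr (map_mx iota E))); apply: exact_comb_ext.
by move=> o /=; rewrite map_mxM.
Qed.

Lemma quad_comb (m0 m1 m2 m3 : nat) (x0 x1 x2 x3 : 'rV[F]_2) :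
    line m0 x0 -> line m1 x1 -> line m2 x2 -> line m3 x3 ->
  quad ((m0 + m1) + (m2 + m3))
    (row_mx (x0 + (x2 + x3)) (x1 + (x2 + x3 *m map_mx iota M))).
Proof.
move=> l0 l1 l2 l3.
have -> : row_mx (x0 + (x2 + x3)) (x1 + (x2 + x3 *m map_mx iota M)) =
    (x0 *m map_mx iota (row_mx 1%:M 0) + x1 *m map_mx iota (row_mx 0 1%:M)) +
    (x2 *m map_mx iota (row_mx 1%:M 1%:M) + x3 *m map_mx iota (row_mx 1%:M M)).
  rewrite !map_row_mx !map_mx1 !map_mx0 !mul_mx_row !mulmx1 !mulmx0 !add_row_mx.
  by rewrite addr0 add0r.
apply: exact_comb_sum; first apply: exact_comb_sum; try exact: line_map.
by apply: exact_comb_sum; exact: line_map.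
Qed.

Lemma line_comb0 : line 0 0. Proof. exact: exact_comb0. Qed.

(** If both halves of [v] are nonzero, the first two lines give two points each. If one half
    vanishes, a point of the third line is split off, after which that half takes one point and the
    other half, kept nonzero by the choice of [c], takes two. *)
Lemma quad_comb4 (v : 'rV[F]_(2 + 2)) : quad 4 v.
Proof.
rewrite -[v]hsubmxK; set s := lsubmx v; set t := rsubmx v.
pose e := map_mx iota (rv2 1 0).
have e_neq0 : rv2 1 0 != 0 :> 'rV[K]_2 by rewrite rv2_eq0 oner_eq0.
have ce_neq0 (x : 'rV[F]_2) c : c != x 0 0 -> x - c *: e != 0.
  apply: contraNneq => /matrixP/(_ 0 0); rewrite !mxE rmorph1 mulr1 => /eqP.
  by rewrite subr_eq0 eq_sym.
have [s0|s_neq0] := eqVneq s 0.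
  have [|c] := @exists_notin _ [:: 0; t 0 0]; first exact: ltnW F_gt3.
  rewrite !inE negb_or => /andP[c_neq0 c_neq].
  have cN_neq0 : - c != 0 by rewrite oppr_eq0.
  have := quad_comb (line_comb1 iota e_neq0 cN_neq0) (line_comb2 iota K_gt2 (ce_neq0 _ _ c_neq))
    (line_comb1 iota e_neq0 c_neq0) line_comb0.
  rewrite mul0mx !addr0 scaleNr addNr subrK s0; exact.
have [t0|t_neq0] := eqVneq t 0.
  have [|c] := @exists_notin _ [:: 0; s 0 0]; first exact: ltnW F_gt3.
  rewrite !inE negb_or => /andP[c_neq0 c_neq].
  have cN_neq0 : - c != 0 by rewrite oppr_eq0.
  have := quad_comb (line_comb2 iota K_gt2 (ce_neq0 _ _ c_neq)) (line_comb1 iota e_neq0 cN_neq0)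
    (line_comb1 iota e_neq0 c_neq0) line_comb0.
  rewrite mul0mx !addr0 scaleNr addNr subrK t0; exact.
have := quad_comb (line_comb2 iota K_gt2 s_neq0) (line_comb2 iota K_gt2 t_neq0)
  line_comb0 line_comb0.
by rewrite mul0mx !addr0.
Qed.

Lemma quad_comb5 (v : 'rV[F]_(2 + 2)) : quad 5 v.
Proof.
rewrite -[v]hsubmxK; set s := lsubmx v; set t := rsubmx v.
pose e := map_mx iota (rv2 1 0).
have e_neq0 : rv2 1 0 != 0 :> 'rV[K]_2 by rewrite rv2_eq0 oner_eq0.
have ce_neq0 (x : 'rV[F]_2) c : c != x 0 0 -> x - c *: e != 0.
  apply: contraNneq => /matrixP/(_ 0 0); rewrite !mxE rmorph1 mulr1 => /eqP.
  by rewrite subr_eq0 eq_sym.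
have [|c] := @exists_notin _ [:: 0; s 0 0; t 0 0]; first exact: F_gt3.
rewrite !inE !negb_or => /and3P[c_neq0 c_s c_t].
have := quad_comb (line_comb2 iota K_gt2 (ce_neq0 _ _ c_s))
  (line_comb2 iota K_gt2 (ce_neq0 _ _ c_t)) (line_comb1 iota e_neq0 c_neq0) line_comb0.
by rewrite mul0mx !addr0 !subrK.
Qed.

(** A nonzero kernel vector would be an eigenvector for the eigenvalue 0. *)
Lemma M_unit : M \in unitmx.
Proof.
rewrite -unitmx_tr -row_free_unit; apply: inj_row_free => v vM.
apply/eqP; apply: contraT => v_neq0.
have /M_no_eig/eqP[] : v^T != 0 by rewrite -trmx0 (inj_eq trmx_inj).
have perp0 : perp 0 = 0 :> 'rV[K]_2.
  by apply/eqP; rewrite rv2_eq0 !mxE oppr0 eqxx.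
by rewrite -[M]trmxK -trmx_mul vM trmx0 perp0 mul0mx.
Qed.

Lemma line_comb01 (p : 'rV[K]_2) (a : F) :
  p != 0 -> line (a != 0) (a *: map_mx iota p).
Proof.
move=> p_neq0; have [->|a_neq0] := eqVneq a 0; last exact: line_comb1.
by rewrite scale0r; apply: line_comb0.
Qed.

Lemma line_scale_neq0 (p : 'rV[K]_2) (a : F) :
  p != 0 -> a != 0 -> a *: map_mx iota p != 0.
Proof. by move=> p_neq0 a_neq0; rewrite scaler_eq0 negb_or a_neq0 map_mx_eq0. Qed.

(* Replacing a point by two or three other points of its line raises the number of
   points used to exactly three. *)
Lemma line_comb_raise3 (p q r : 'rV[K]_2) (a b c : F) :
    p != 0 -> q != 0 -> r != 0 ->
  exists m1 m2 m3, [/\ line m1 (a *: map_mx iota p), line m2 (b *: map_mx iota q),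
     line m3 (c *: map_mx iota r) & (m1 + m2 + m3 = 3)%N].
Proof.
move=> p_neq0 q_neq0 r_neq0.
have [a0|a_neq0] := eqVneq a 0; last first.
  case: (eqVneq b 0) (line_comb01 b q_neq0) (eqVneq c 0) (line_comb01 c r_neq0)
    => _ lb [] _ lc.
  - by exists 3, 0%N, 0%N; split=> //; apply: line_comb3.
  - exists 2, 0%N, 1%N; split=> //; apply: line_comb2 => //; exact: line_scale_neq0.
  - exists 2, 1%N, 0%N; split=> //; apply: line_comb2 => //; exact: line_scale_neq0.
  - by exists 1%N, 1%N, 1%N; split=> //; apply: line_comb1.
have l0 : line 0 (a *: map_mx iota p) by rewrite a0 scale0r; apply: line_comb0.
have [b0|b_neq0] := eqVneq b 0.
  exists 0%N, 0%N, 3; split=> //; last exact: line_comb3.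
  by rewrite b0 scale0r; apply: line_comb0.
case: (eqVneq c 0) (line_comb01 c r_neq0) => _ lc.
  by exists 0%N, 3, 0%N; split=> //; apply: line_comb3.
by exists 0%N, 2, 1%N; split=> //; apply: line_comb2 => //; exact: line_scale_neq0.
Qed.

Lemma line_comb_raise2 (x : 'rV[F]_2) (q : 'rV[K]_2) (b : F) :
    q != 0 -> (b != 0 -> x != 0) ->
  exists m n, [/\ line m x, line n (b *: map_mx iota q) & (m + n = 3)%N].
Proof.
move=> q_neq0; have [->{b} _|b_neq0 /(_ isT) x_neq0] := eqVneq b 0.
  exists 3, 0%N; split=> //; first exact: line_comb3.
  by rewrite scale0r; apply: line_comb0.
by exists 2, 1%N; split=> //; [apply: line_comb2|apply: line_comb1].
Qed.

(** The hyperplane [f] = (g, h) meets the four lines where x is orthogonal to g, h, g + h and g + M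
    h respectively. If one of these vanishes, its line lies in the hyperplane, and [v] is a vector
    of that line plus a multiple of the trace of another. Otherwise three traces span: those of the
    first three lines if g and h are independent, else the first, second and fourth, as [M] has no
    eigenvector. *)
Lemma quad_comb3 (v : 'rV[F]_(2 + 2)) (f : 'cV[K]_(2 + 2)) :
  f != 0 -> v *m map_mx iota f = 0 -> quad 3 v.
Proof.
rewrite -[v]hsubmxK -[f]vsubmxK; set s := lsubmx v; set t := rsubmx v.
set g := usubmx f; set h := dsubmx f.
rewrite map_col_mx mul_row_col => gh_neq0 st0.
have Mi_neq0 (k : 'cV[K]_2) : k != 0 -> map_mx iota k != 0 by rewrite map_mx_eq0.
have mapp (k : 'cV[K]_2) : perp (map_mx iota k) = map_mx iota (perp k).
  by rewrite /perp map_rv2 !mxE rmorphN.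
have Perp (x : 'rV[F]_2) k : k != 0 -> x *m map_mx iota k = 0 ->
    exists a, x = a *: map_mx iota (perp k).
  by move=> k_neq0 xk; rewrite -mapp; apply: perpP => //; apply: Mi_neq0.
have Q m0 m1 m2 m3 x0 x1 x2 x3 : line m0 x0 -> line m1 x1 -> line m2 x2 -> line m3 x3 ->
    (m0 + m1 + m2 + m3 = 3)%N -> x0 + x2 + x3 = s -> x1 + x2 + x3 *m map_mx iota M = t ->
    quad 3 (row_mx s t).
  by move=> l0 l1 l2 l3 <- <- <-; rewrite -!addrA -addnA; apply: quad_comb.
have [h0|h_neq0] := eqVneq h 0.
  have g_neq0 : g != 0 by apply: contraNneq gh_neq0 => ->; rewrite h0 col_mx0.
  have [a Da] : exists a, s = a *: map_mx iota (perp g).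
    by apply: Perp => //; move: st0; rewrite h0 map_mx0 mulmx0 addr0.
  have [|] := boolP ((a != 0) ==> (t != 0)).
    move/implyP=> /(line_comb_raise2 (perp_neq0 g_neq0))[m [n [lm ln mn]]].
    by apply: (Q _ _ _ _ _ _ _ _ ln lm line_comb0 line_comb0);
      rewrite ?mul0mx ?addr0 ?addn0 // addnC.
  rewrite negb_imply negbK => /andP[a_neq0 /eqP t0].
  have s_neq0 : s != 0 by rewrite Da line_scale_neq0 ?perp_neq0.
  apply: (Q 0%N 2 1%N 0%N 0 (- s) s 0 line_comb0 (line_comb2 iota K_gt2 _) _ line_comb0) => //.
  - by rewrite oppr_eq0.
  - by rewrite Da; apply: line_comb1 => //; apply: perp_neq0.
  - by rewrite add0r addr0.
  - by rewrite addNr mul0mx addr0 t0.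
have [g0|g_neq0] := eqVneq g 0.
  have [a Da] : exists a, t = a *: map_mx iota (perp h).
    by apply: Perp => //; move: st0; rewrite g0 map_mx0 mulmx0 add0r.
  have [|] := boolP ((a != 0) ==> (s != 0)).
    move/implyP=> /(line_comb_raise2 (perp_neq0 h_neq0))[m [n [lm ln mn]]].
    by apply: (Q _ _ _ _ _ _ _ _ lm ln line_comb0 line_comb0);
      rewrite ?mul0mx ?addr0 ?addn0.
  rewrite negb_imply negbK => /andP[a_neq0 /eqP s0].
  have t_neq0 : t != 0 by rewrite Da line_scale_neq0 ?perp_neq0.
  apply: (Q 2 0%N 1%N 0%N (- t) 0 t 0 (line_comb2 iota K_gt2 _) line_comb0 _ line_comb0) => //.
  - by rewrite oppr_eq0.
  - by rewrite Da; apply: line_comb1 => //; apply: perp_neq0.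
  - by rewrite addNr addr0 s0.
  - by rewrite add0r mul0mx addr0.
have [gh0|gh_neq] := eqVneq (g + h) 0.
  have [a Da] : exists a, s - t = a *: map_mx iota (perp g).
    apply: Perp => //; rewrite mulmxBl -[RHS]st0; congr (_ + _).
    by rewrite -(addr0_eq gh0) map_mxN mulmxN.
  have [|] := boolP ((a != 0) ==> (t != 0)).
    move/implyP=> /(line_comb_raise2 (perp_neq0 g_neq0))[m [n [lm ln mn]]].
    apply: (Q _ _ _ _ _ _ _ _ ln line_comb0 lm line_comb0);
      rewrite ?mul0mx ?addr0 ?add0r ?addn0 // 1?addnC // -Da.
    exact: subrK.
  rewrite negb_imply negbK => /andP[a_neq0 /eqP t0].
  rewrite t0 subr0 in Da.
  have s_neq0 : s != 0 by rewrite Da line_scale_neq0 ?perp_neq0.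
  apply: (Q 0%N 1%N 2 0%N 0 (- s) s 0 line_comb0 _ (line_comb2 iota K_gt2 _) line_comb0) => //.
  - by rewrite Da -scaleNr; apply: line_comb1; rewrite ?oppr_eq0 ?perp_neq0.
  - by rewrite add0r addr0.
  - by rewrite addNr mul0mx addr0 t0.
have [gMh0|gMh_neq] := eqVneq (g + M *m h) 0.
  have [a Da] : exists a, t - s *m map_mx iota M = a *: map_mx iota (perp h).
    apply: Perp => //; rewrite mulmxBl -mulmxA -map_mxM addrC -[RHS]st0; congr (_ + _).
    by rewrite -(addr0_eq gMh0) map_mxN mulmxN opprK.
  have [|] := boolP ((a != 0) ==> (s != 0)).
    move/implyP=> /(line_comb_raise2 (perp_neq0 h_neq0))[m [n [lm ln mn]]].
    apply: (Q _ _ _ _ _ _ _ _ line_comb0 ln line_comb0 lm);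
      rewrite ?addr0 ?add0r ?addn0 // 1?addnC // -Da.
    exact: subrK.
  rewrite negb_imply negbK => /andP[a_neq0 /eqP s0].
  rewrite s0 mul0mx subr0 in Da.
  (* On the fourth line [a *: p] gives (a p, a perp h); [- a *: p] on the first line cancels the
     left half. *)
  pose p := perp h *m invmx M.
  have p_neq0 : p != 0.
    apply: contraNneq (perp_neq0 h_neq0) => p0.
    by rewrite -[perp h](mulmxKV M_unit) -/p p0 mul0mx.
  apply: (Q 1%N 0%N 0%N 2 (- a *: map_mx iota p) 0 0 (a *: map_mx iota p)
            (line_comb1 iota p_neq0 _) line_comb0 line_comb0 (line_comb2 iota K_gt2 _)) => //.
  - by rewrite oppr_eq0.
  - exact: line_scale_neq0.
  - by rewrite scaleNr addr0 addNr s0.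
  - by rewrite !add0r -scalemxAl -map_mxM mulmxKV ?M_unit // Da.
(* In both cases [c] makes the remaining left half orthogonal to [g]; by [st0] the remaining right
   half is then orthogonal to [h]. *)
have [gh_par|gh_indep] := eqVneq (perp g *m h) 0.
  have [l Dh] := perp_par g_neq0 gh_par.
  have Mhg_neq0 : perp (M *m h) *m g != 0.
    by apply: contraNneq (M_no_eig h_neq0) => Mhg0; rewrite {2}Dh -scalemxAr Mhg0 scaler0.
  pose p := perp (g + M *m h).
  have [c Dc] : exists c, s *m map_mx iota g = c *: (map_mx iota p *m map_mx iota g).
    apply: mx11_scale; rewrite -map_mxM map_mx_eq0.
    by rewrite /p perpD mulmxDl perp_mul add0r.
  have [a Da] : exists a, s - c *: map_mx iota p = a *: map_mx iota (perp g).
    by apply: Perp => //; rewrite mulmxBl -scalemxAl -Dc subrr.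
  have [b Db] : exists b, t - c *: map_mx iota p *m map_mx iota M
                          = b *: map_mx iota (perp h).
    apply: Perp => //; rewrite mulmxBl -!scalemxAl -mulmxA -map_mxM.
    have -> : map_mx iota p *m map_mx iota (M *m h) = - (map_mx iota p *m map_mx iota g).
      by apply/eqP; rewrite -addr_eq0 addrC -mulmxDr -map_mxD -map_mxM perp_mul map_mx0.
    by rewrite scalerN opprK -Dc addrC.
  have [m1 [m2 [m3 [l1 l2 l3 mm]]]] :=
    line_comb_raise3 a b c (perp_neq0 g_neq0) (perp_neq0 h_neq0) (perp_neq0 gMh_neq).
  apply: (Q _ _ _ _ _ _ _ _ l1 l2 line_comb0 l3); rewrite ?addr0 ?addn0 //.
    by rewrite -Da subrK.
  by rewrite -Db subrK.
have [c Dc] : exists c, s *m map_mx iota g =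
    c *: (map_mx iota (perp (g + h)) *m map_mx iota g).
  apply: mx11_scale; rewrite -map_mxM map_mx_eq0.
  by rewrite perpD mulmxDl perp_mul add0r perp_mulC oppr_eq0.
have [a Da] : exists a, s - c *: map_mx iota (perp (g + h)) = a *: map_mx iota (perp g).
  by apply: Perp => //; rewrite mulmxBl -scalemxAl -Dc subrr.
have [b Db] : exists b, t - c *: map_mx iota (perp (g + h)) = b *: map_mx iota (perp h).
  apply: Perp => //; rewrite mulmxBl -scalemxAl.
  have -> : map_mx iota (perp (g + h)) *m map_mx iota h =
            - (map_mx iota (perp (g + h)) *m map_mx iota g).
    by apply/eqP; rewrite -addr_eq0 addrC -mulmxDr -map_mxD -map_mxM perp_mul map_mx0.
  by rewrite scalerN opprK -Dc addrC.
have [m1 [m2 [m3 [l1 l2 l3 mm]]]] :=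
  line_comb_raise3 a b c (perp_neq0 g_neq0) (perp_neq0 h_neq0) (perp_neq0 gh_neq).
apply: (Q _ _ _ _ _ _ _ _ l1 l2 l3 line_comb0); rewrite ?mul0mx ?addr0 ?addn0 //.
  by rewrite -Da subrK.
by rewrite -Db subrK.
Qed.

End FourLines.

(** * Hyperplanes over K and the point set built on the four lines *)

(** Pigeonhole for the additive map [phi] from K^d to F: the difference of two vectors with the same
    image is the required [f]. *)
Lemma exists_annihilator (F K : finFieldType) (iota : {rmorphism K -> F}) (n d : nat)
    (u : 'rV[F]_d) :
    #|F| = (#|K| ^ n)%N -> (n < d)%N ->
  exists2 f : 'cV[K]_d, f != 0 & u *m map_mx iota f = 0.
Proof.
move=> oF lt_nd; pose phi (f : 'cV[K]_d) := (u *m map_mx iota f) 0 0.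
have /injectivePn[f [g fg phi_fg]] : ~~ injectiveb phi.
  apply: contraTN lt_nd => /injectiveP/leq_card.
  by rewrite card_mx oF muln1 leq_exp2l ?finNzRing_gt1 // -leqNgt.
exists (f - g); first by rewrite subr_eq0.
rewrite map_mxB mulmxBr; apply/eqP; rewrite subr_eq0; apply/eqP/matrixP=> i j.
by rewrite !ord1; apply: phi_fg.
Qed.

Lemma card_edge (N : nat) (dim := (N + (2 + 2))%N) :
  #|{: {p : 'I_N * 'I_dim | (p.1 < p.2)%N}}| = (4 * N + 'C(N, 2))%N.
Proof.
rewrite card_sig -sum1_card (eq_bigl (fun p : 'I_N * 'I_dim => (p.1 < p.2)%N)) //.
rewrite -(pair_big_dep predT (fun (i : 'I_N) (k : 'I_dim) => (i < k)%N) (fun _ _ => 1%N)) /=.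
have E (i : 'I_N) : (\sum_(k < dim | i < k) 1 = 4 + (N - i.+1))%N.
  rewrite -(big_mkord (fun k => i < k)%N (fun=> 1%N)).
  rewrite -(@big_nat_widenl _ _ _ i.+1 0 dim predT) // sum_nat_const_nat.
  have := ltn_ord i; lia.
rewrite (eq_bigr _ (fun i _ => E i)) big_split /= sum_nat_const card_ord mulnC.
have -> : (\sum_(i < N) (N - i.+1) = \sum_(0 <= i < N) i)%N.
  by rewrite big_rev_mkord subn0.
by rewrite bin2_sum.
Qed.

Section Simplex.

Variables (F K : finFieldType) (iota : {rmorphism K -> F}).
Hypotheses (K_gt2 : (2 < #|K|)%N) (F_gt3 : (3 < #|F|)%N).
Variable M : 'M[K]_2.
Hypothesis M_no_eig : forall h : 'cV_2, h != 0 -> perp (M *m h) *m h != 0.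
Variable N : nat.
Hypothesis oF : #|F| = (#|K| ^ (N + 3))%N.

Local Notation dim := (N + (2 + 2))%N.
Local Notation edge := {p : 'I_N * 'I_dim | (p.1 < p.2)%N}.
Local Notation scalar := {c : K | c != 0}.
Local Notation quad := (exact_comb (fun k => map_mx iota (quad_pt M k))).

Definition apex_pt (k : 'I_N + edge * scalar) : 'rV[K]_dim :=
  match k with
  | inl i => delta_mx 0 (lshift (2 + 2) i)
  | inr (p, c) => delta_mx 0 (lshift (2 + 2) (val p).1) + val c *: delta_mx 0 (val p).2
  end.

Definition simplex_pt k : 'rV[K]_dim :=
  match k with inl k => apex_pt k | inr k => row_mx 0 (quad_pt M k) end.

Local Notation apex := (exact_comb (fun k => map_mx iota (apex_pt k))).
Local Notation simplex := (exact_comb (fun k => map_mx iota (simplex_pt k))).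

Lemma simplex_comb (m n : nat) (u v : 'rV[F]_dim) :
    apex m v -> lsubmx (u - v) = 0 -> quad n (rsubmx (u - v)) ->
  simplex (m + n) u.
Proof.
move=> av uv0 qw; rewrite -[u](subrK v) addrC -[u - v]hsubmxK uv0.
apply: exact_comb_sum; first exact: av.
have := exact_comb_map (mulmxr (row_mx (0 : 'M[F]_(_, N)) 1%:M)) qw.
rewrite /= mul_mx_row mulmx0 mulmx1; apply: exact_comb_ext => k /=.
by rewrite mul_mx_row mulmx0 mulmx1 map_row_mx map_mx0.
Qed.

Lemma exact_comb_family (V : lmodType F) (J : finType) (c : J -> V) (a : J -> F) :
  exact_comb c #|[set j | a j != 0]| (\sum_j a j *: c j).
Proof. by exists a. Qed.

(* Of the z vanishing apex coordinates, (z - 1) / 2 absorb two points each, a vertex and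
   a point of an edge; the four lines provide the remaining four or five points. *)
Lemma simplex_comb_zero (u : 'rV[F]_dim) (i0 : 'I_N) :
  u 0 (lshift _ i0) = 0 -> simplex (N + 3) u.
Proof.
move=> ui0; pose Z := [set i : 'I_N | u 0 (lshift _ i) == 0].
have Z_gt0 : (0 < #|Z|)%N by apply/card_gt0P; exists i0; rewrite inE ui0.
have Z_le : (#|Z| <= N)%N by rewrite -[X in (_ <= X)%N]card_ord max_card.
pose a := ((#|Z| - 1) %/ 2)%N.
pose A := [set i in take a (enum Z)].
have cardA : #|A| = a.
  rewrite cardsE (card_uniqP _) ?take_uniq ?enum_uniq // size_takel // -cardE.
  by rewrite /a; lia.
have AZ i : i \in A -> u 0 (lshift _ i) = 0.
  by rewrite inE => /mem_take; rewrite mem_enum inE => /eqP.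
(* For [i] in [A], the vertex e_i and an edge point of the form e_i + e_k enter with coefficients 1
   and -1; they cancel in coordinate [i] and use up two points. *)
pose b i := if i \in A then 1 else u 0 (lshift (2 + 2) i).
pose e (i : 'I_N) : edge * scalar :=
  (Sub (i, rshift N (0 : 'I_(2 + 2))) (leq_trans (ltn_ord i) (leq_addr _ _)),
   Sub 1 (oner_neq0 K)).
pose v1 := \sum_i b i *: map_mx iota (apex_pt (inl i)).
pose v2 := \sum_i (- (i \in A)%:R) *: map_mx iota (apex_pt (inr (e i))).
have av : apex (#|[set i | b i != 0]| + #|[set i | - (i \in A)%:R != 0 :> F]|) (v1 + v2).
  apply: exact_comb_sum; first exact: exact_comb_family.
  apply: (@exact_comb_inj _ _ _ _ _ e); first by move=> i j [].
  exact: exact_comb_family.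
have cardb : #|[set i | b i != 0]| = (N - #|Z| + a)%N.
  have -> : [set i | b i != 0] = ~: Z :|: A.
    apply/setP=> i; rewrite in_setU in_setC [i \in Z]inE inE /b.
    by case: (i \in A); rewrite ?oner_eq0 ?orbT ?orbF.
  have ZA0 : ~: Z :&: A = set0.
    apply/setP=> i; rewrite in_setI in_setC in_set0 [i \in Z]inE.
    by apply/negP=> /andP[/negP ui /AZ/eqP ui0'].
  by rewrite cardsU ZA0 cards0 subn0 cardA; have := cardsC Z; rewrite card_ord; lia.
have cardA' : #|[set i | - (i \in A)%:R != 0 :> F]| = a.
  rewrite -cardA; congr #|pred_of_set _|; apply/setP=> i; rewrite inE oppr_eq0.
  by case: (i \in A); rewrite ?oner_eq0 ?eqxx.
rewrite cardb cardA' in av.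
have uv0 : lsubmx (u - (v1 + v2)) = 0.
  apply/rowP=> l; pose l' := lshift (2 + 2) l.
  have v1l : v1 0 l' = b l.
    rewrite summxE (bigD1 l) //= big1 ?addr0 => [|i il].
      by rewrite !mxE !eqxx rmorph1 mulr1.
    by rewrite !mxE eqxx (inj_eq (@lshift_inj _ _)) eq_sym (negPf il) rmorph0 mulr0.
  have v2l : v2 0 l' = - (l \in A)%:R.
    rewrite summxE (bigD1 l) //= big1 ?addr0 => [|i il].
      by rewrite !mxE !eqxx eq_lrshift mulr0 addr0 rmorph1 mulr1.
    rewrite !mxE eqxx (inj_eq (@lshift_inj _ _)) eq_sym (negPf il) eq_lrshift.
    by rewrite mulr0 addr0 rmorph0 mulr0.
  rewrite 3!mxE [(v1 + v2) 0 _]mxE v1l v2l [RHS]mxE /b.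
  by case: ifP => [/AZ ->|_]; rewrite ?subrr ?oppr0 ?addr0 ?subrr.
have [odd_Z|even_Z] := boolP (odd #|Z|).
  have -> : (N + 3 = (N - #|Z| + a + a) + 4)%N by rewrite /a; lia.
  by apply: (simplex_comb av uv0); apply: quad_comb4.
have -> : (N + 3 = (N - #|Z| + a + a) + 5)%N by rewrite /a; lia.
by apply: (simplex_comb av uv0); apply: quad_comb5.
Qed.

(** [u] lies in a hyperplane [f] over K. With j the last coordinate in the support of [f], the
    points e_i - (f_i / f_j) e_j of this hyperplane, with coefficients u_i, clear the vertex
    coordinates other than j. *)
Lemma simplex_comb_nonzero (u : 'rV[F]_dim) :
  (forall i, u 0 (lshift _ i) != 0) -> simplex (N + 3) u.
Proof.
move=> u_neq0.
have [|f f_neq0 uf] := @exists_annihilator F K iota (N + 3) dim u oF; first lia.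
have [j0 fj0] : exists j, f j 0 != 0.
  apply/existsP; apply: contraNT f_neq0; rewrite negb_exists => /forallP f0.
  apply/eqP/matrixP=> i j; rewrite ord1 mxE; apply/eqP; rewrite -[_ == _]negbK.
  exact: f0.
(* Since [j] is maximal, every apex [i] in the support of [f] precedes it, so that
   the point [e_i - (f_i / f_j) e_j] of the hyperplane is among the [apex_pt]. *)
have [j fj j_max] := @arg_maxnP _ j0 (fun j => f j 0 != 0) (@nat_of_ord _) fj0.
pose h (i : 'I_N) : 'I_N + edge * scalar :=
  if insub (i, j) is Some p then
    if insub (- (f (lshift _ i) 0 / f j 0)) is Some c then inr (p, c) else inl i
  else inl i.
have h_inj : injective h.
  pose pr (k : 'I_N + edge * scalar) :=
    match k with inl i => i | inr (p, _) => (val p).1 end.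
  apply: (can_inj (g := pr)) => i; rewrite /h.
  by case: insubP => //= p _ Dp; case: insubP => //= c _ _; rewrite Dp.
have hE i : lshift _ i != j -> apex_pt (h i) =
    delta_mx 0 (lshift _ i) - (f (lshift _ i) 0 / f j 0) *: delta_mx 0 j.
  move=> ij; rewrite /h; case: insubP => [p _ Dp|/=].
    case: insubP => [c _ Dc|/negPn/eqP Dc] /=; rewrite ?Dp ?Dc ?scaleNr //.
    by rewrite -scaleNr Dc scale0r addr0.
  rewrite -leqNgt => le_ji.
  have [->|fi] := eqVneq (f (lshift _ i) 0) 0.
    by rewrite mul0r scale0r subr0.
  have /= le_ij := j_max _ fi.
  by case/eqP: ij; apply: val_inj; apply/eqP; rewrite eqn_leq /= le_ij.
pose a i := if lshift _ i != j then u 0 (lshift (2 + 2) i) else 0.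
pose v := \sum_i a i *: map_mx iota (apex_pt (h i)).
have av : apex #|[set i | a i != 0]| v.
  apply: (@exact_comb_inj _ _ _ _ _ h) => //.
  exact: exact_comb_family.
have vf : v *m map_mx iota f = 0.
  rewrite mulmx_suml big1 // => i _; rewrite /a; case: ifP => [ij|_]; last first.
    by rewrite scale0r mul0mx.
  rewrite -scalemxAl -map_mxM hE // mulmxBl -scalemxAl -!rowE.
  have -> : row (lshift _ i) f - (f (lshift _ i) 0 / f j 0) *: row j f = 0.
    by apply/rowP=> z; rewrite !mxE ord1 divfK // subrr.
  by rewrite map_mx0 scaler0.
have uv_l l : lshift _ l != j -> (u - v) 0 (lshift _ l) = 0.
  move=> lj; rewrite mxE [(- v) _ _]mxE summxE (bigD1 l) //= big1 => [|i il].
    by rewrite addr0 /a lj hE // !mxE !eqxx (negPf lj) mulr0 subr0 rmorph1 mulr1 subrr.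
  rewrite /a; case: ifP => [ij|_]; last by rewrite scale0r mxE.
  rewrite hE // !mxE eqxx (inj_eq (@lshift_inj _ _)) eq_sym (negPf il) (negPf lj).
  by rewrite mulr0 subr0 rmorph0 mulr0.
have uvf : (u - v) *m map_mx iota f = 0 by rewrite mulmxBl uf vf subrr.
(* If [j] is a vertex, the equation of the hyperplane clears its coordinate too: N - 1 points are
   used and four remain. Otherwise N are used, and the rest lies in a hyperplane of the last four
   coordinates, where three suffice. *)
case: (split_ordP j) => [i Dj|k Dj].
  have -> : (N + 3 = #|[set i | a i != 0%R]| + 4)%N.
    have -> : [set k | a k != 0] = [set~ i].
      apply/setP=> k; rewrite !inE /a Dj (inj_eq (@lshift_inj _ _)).
      by case: ifP; rewrite ?u_neq0 ?eqxx.
    by rewrite cardsC1 card_ord; have := ltn_ord i; lia.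
  apply: (simplex_comb av); last exact: quad_comb4.
  apply/rowP=> l; rewrite mxE [RHS]mxE; have [lj|] := eqVneq (lshift _ l) j; last exact: uv_l.
  have /matrixP/(_ 0 0) := uvf; rewrite mxE [RHS]mxE (bigD1 j) //= big1 ?addr0 => [|k kj].
    by rewrite lj => /eqP; rewrite mulf_eq0 [map_mx _ _ _ _]mxE fmorph_eq0 (negPf fj) orbF => /eqP.
  case: (split_ordP k) kj => l' -> kj; first by rewrite uv_l // mul0r.
  have [fk|/j_max] := eqVneq (f (rshift N l') 0) 0.
    by rewrite [map_mx _ _ _ _]mxE fk rmorph0 mulr0.
  by rewrite Dj /= leqNgt (leq_trans (ltn_ord i)) // leq_addr.
have uv0 : lsubmx (u - v) = 0.
  by apply/rowP=> l; rewrite mxE [RHS]mxE uv_l // Dj eq_lrshift.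
have -> : (N + 3 = #|[set i | a i != 0%R]| + 3)%N.
  have -> : [set i | a i != 0] = setT; last by rewrite cardsT card_ord.
  by apply/setP=> i; rewrite !inE /a Dj eq_lrshift u_neq0.
apply: (simplex_comb av uv0).
apply: (@quad_comb3 _ _ _ _ _ _ _ _ (dsubmx f)) => //.
  apply: contraNneq fj => /matrixP/(_ k 0); rewrite !mxE -Dj => fj0'.
  by rewrite /= fj0'.
move: uvf; rewrite -{1}[u - v]hsubmxK uv0 -[f in map_mx _ f]vsubmxK map_col_mx.
by rewrite mul_row_col mul0mx add0r.
Qed.

Lemma simplex_exact_cover (u : 'rV[F]_dim) : simplex (N + 3) u.
Proof.
have [/existsP[i /eqP]|no_zero] := boolP [exists i, u 0 (lshift (2 + 2) i) == 0].
  exact: simplex_comb_zero.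
apply: simplex_comb_nonzero => i; apply: contraNN no_zero => ui.
by apply/existsP; exists i.
Qed.

End Simplex.

(** Indexing by ['I_m] makes the Vandermonde matrix of the labels square. *)
Lemma exact_comb_enum (F : fieldType) (V : lmodType F) (J : finType) (c : J -> V)
    (m : nat) (u : V) :
    exact_comb c m u ->
  exists (s : 'I_m -> J) (a : 'I_m -> F),
    [/\ injective s, forall i, a i != 0 & u = \sum_i a i *: c (s i)].
Proof.
move=> [a Da ->]; case: m / Da; exists enum_val, (a \o enum_val); split.
- exact: enum_val_inj.
- by move=> i; have := enum_valP i; rewrite inE.
rewrite -(big_enum_val (fun j => a j *: c j)) [LHS](bigID (mem [set j | a j != 0])) /=.
by rewrite [X in _ + X]big1 ?addr0 // => j; rewrite inE negbK => /eqP->; rewrite scale0r.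
Qed.

Lemma exists_injection (A B : finType) :
  (#|A| <= #|B|)%N -> exists f : A -> B, injective f.
Proof.
move=> le_AB; exists (fun x => enum_val (widen_ord le_AB (enum_rank x))) => x y.
by move=> /enum_val_inj/(congr1 val) /= /ord_inj/enum_rank_inj.
Qed.

(** * A vector needing as many summands as F has dimensions over K *)

Section Spanning.

Variables (F K : finFieldType) (iota : {rmorphism K -> F}) (n : nat).
Hypothesis oF : #|F| = (#|K| ^ n)%N.

(** Each new entry is taken outside the K-span of the previous ones, which keeps the map injective;
    once the span is all of F, zeros are added. *)
Lemma exists_spanning_col (d : nat) :
  exists u : 'cV[F]_d,
    injective (fun y : 'rV[K]_d => map_mx iota y *m u) \/
    forall z : 'M[F]_1, exists y : 'rV[K]_d, z = map_mx iota y *m u.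
Proof.
elim: d => [|d [u Hu]]; first by exists 0; left=> y z _; apply/rowP=> -[].
rewrite -[d.+1]/(1 + d)%N; pose phi (y : 'rV[K]_d) := map_mx iota y *m u.
have [/forallP surj|/forallPn[z z_notin]] := boolP [forall z, z \in codom phi].
  exists (col_mx 0 u : 'cV_(1 + d)); right=> z; have /codomP[y ->] := surj z.
  by exists (row_mx (0 : 'M_1) y); rewrite map_row_mx mul_row_col mulmx0 add0r.
have {Hu} u_inj : injective phi.
  by case: Hu => // /(_ z)[y Dz]; case/codomP: z_notin; exists y.
exists (col_mx z u : 'cV_(1 + d)); left=> /= y1 y2.
move=> y12; apply/eqP; rewrite -subr_eq0.
have : map_mx iota (y1 - y2) *m col_mx z u = 0 by rewrite map_mxB mulmxBl y12 subrr.
rewrite -[y1 - y2]hsubmxK; set k := lsubmx _; set w := rsubmx _.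
rewrite map_row_mx mul_row_col => kw.
have [k0|k_neq0] := eqVneq k 0.
  have /u_inj -> : phi w = phi 0.
    by rewrite /phi map_mx0 mul0mx -[RHS]kw k0 map_mx0 mul0mx add0r.
  by rewrite k0 row_mx0.
case/negP: z_notin; apply/codomP; exists (- (k 0 0)^-1 *: w).
have k00 : k 0 0 != 0.
  by apply: contraNneq k_neq0 => k00; rewrite [k]mx11_scalar k00 raddf0.
rewrite /phi map_mxZ -scalemxAl rmorphN fmorphV scaleNr -scalerN.
rewrite -(addr0_eq kw) opprK [k]mx11_scalar map_scalar_mx mul_scalar_mx.
by rewrite mxE mulr1n scalerA mulVf ?scale1r ?fmorph_eq0.
Qed.

(** The entries of [u] are made to span F over K. They lie in the K-span of the coefficients [a j],
    so F has at most [#|K| ^ #|J|] elements. *)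
Lemma exists_rank_vector (d : nat) : (n < d)%N ->
  exists u : 'rV[F]_d, forall (I : finType) (c : I -> 'rV[K]_d) (J : {set I}) (a : I -> F),
    u = \sum_(j in J) a j *: map_mx iota (c j) -> (n <= #|J|)%N.
Proof.
move=> lt_nd; have [u [u_inj|u_surj]] := exists_spanning_col d.
  have := leq_card _ u_inj; rewrite !card_mx oF mul1n !muln1.
  by rewrite leq_exp2l ?finNzRing_gt1 // leqNgt lt_nd.
exists u^T => I c J a Du.
pose phi (w : 'rV[K]_#|J|) : F := \sum_i a (enum_val i) * iota (w 0 i).
have phi_surj z : z \in codom phi.
  have [y Dz] := u_surj z%:M; apply/codomP; exists (\row_i (c (enum_val i) *m y^T) 0 0).
  have -> : z = (u^T *m map_mx iota y^T) 0 0.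
    by rewrite -map_trmx -trmx_mul -Dz !mxE eqxx.
  rewrite Du mulmx_suml summxE big_enum_val; apply: eq_bigr => i _.
  by rewrite -scalemxAl -map_mxM !mxE.
have : (#|F| <= #|{: 'rV[K]_#|J|}|)%N.
  apply: leq_trans (leq_image_card phi predT); apply: subset_leq_card.
  by apply/subsetP=> z _; apply: phi_surj.
by rewrite card_mx mul1n oF leq_exp2l ?finNzRing_gt1.
Qed.

End Spanning.

(** * Raising the codimension with a Vandermonde matrix *)

Section Concatenation.

Variables (F : fieldType) (J : finType) (d R m : nat) (h : J -> 'rV[F]_d) (b : J -> F).
Hypothesis b_inj : injective b.
Variable X : finType.
Variable xi : X -> 'rV[F]_m.
Hypothesis xi_surj : forall v, exists x, xi x = v.

Definition concat_col (k : J * X) : 'rV[F]_(d + R * m) :=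
  row_mx (h k.1) (mxvec ((\col_(i < R) b k.1 ^+ i) *m xi k.2)).

(** The second block requires the sum of the a_i b_i^k x_i to be its row k for all k < R. The labels
    being distinct, the Vandermonde system gives the a_i x_i, and hence x_i, since all R
    coefficients a_i are nonzero. *)
Lemma concat_exact_cover :
    (forall u, exact_comb h R u) ->
  forall s, exact_comb concat_col R s.
Proof.
move=> h_cover s; have [sg [a [sg_inj a_neq0 Ds]]] := exact_comb_enum (h_cover (lsubmx s)).
pose V := Vandermonde R (\row_i b (sg i)).
have V_unit : V \in unitmx.
  rewrite unitmxE det_Vandermonde unitfE; apply/prodf_neq0 => i _.
  apply/prodf_neq0 => j lt_ij; rewrite !mxE subr_eq0 (inj_eq b_inj) (inj_eq sg_inj).
  by apply: contraTneq lt_ij => ->; rewrite ltnn.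
pose T := invmx V *m vec_mx (rsubmx s).
have [x Dx] : exists x : 'I_R -> X, forall i, xi (x i) = (a i)^-1 *: row i T.
  have /fin_all_exists[x Dx] := fun i => xi_surj ((a i)^-1 *: row i T).
  by exists x.
pose g i := (sg i, x i).
have -> : s = \sum_i a i *: concat_col (g i).
  rewrite -[LHS]hsubmxK Ds -[rsubmx s]vec_mxK.
  have -> : vec_mx (rsubmx s) = \sum_i a i *: ((\col_(k < R) b (sg i) ^+ k) *m xi (x i)).
    rewrite -[LHS](mulKVmx V_unit) -/T; apply/matrixP=> k l.
    rewrite mxE summxE; apply: eq_bigr => i _.
    by rewrite !mxE big_ord1 !mxE Dx !mxE [RHS]mulrCA mulVKf.
  rewrite -[RHS]hsubmxK !linear_sum; congr row_mx; apply: eq_bigr => i _.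
    by rewrite linearZ /= row_mxKl.
  by rewrite !linearZ /= row_mxKr.
apply: (@exact_comb_inj _ _ _ _ _ g); first by move=> i j [/sg_inj].
exists a => //; rewrite -[RHS]card_ord -cardsT; congr #|pred_of_set _|.
by apply/setP=> i; rewrite !inE a_neq0.
Qed.

End Concatenation.

(** * From a spanning family of columns to a code *)

Section CodeOfColumns.

Variables (F : fieldType) (I : finType) (r : nat) (c : I -> 'rV[F]_r).

Definition spans_within (R : nat) : Prop :=
  forall s : 'rV[F]_r, exists (J : {set I}) (a : I -> F),
    (#|J| <= R)%N /\ s = \sum_(j in J) a j *: c j.

Let H : 'M[F]_(r, #|I|) := \matrix_(i, j) c (enum_val j) 0 i.

Lemma col_column_matrix j : col j H = (c (enum_val j))^T.
Proof. by apply/matrixP=> i k; rewrite !mxE ord1. Qed.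

Lemma covered_by_columnsP (R : nat) : covered_by_columns H R <-> spans_within R.
Proof.
split=> cover s.
  have [J [a [leJ Ds]]] := cover s^T.
  exists (enum_val @: J), (a \o enum_rank); split; first exact: leq_trans (leq_imset_card _ _) leJ.
  rewrite big_imset /=; last by move=> i j _ _; apply: enum_val_inj.
  rewrite -[s]trmxK Ds linear_sum; apply: eq_bigr => j _.
  by rewrite enum_valK col_column_matrix linearZ /= trmxK.
have [J [a [leJ Ds]]] := cover s^T.
exists (enum_rank @: J), (a \o enum_val); split; first exact: leq_trans (leq_imset_card _ _) leJ.
rewrite big_imset /=; last by move=> i j _ _; apply: enum_rank_inj.
rewrite -[s]trmxK Ds linear_sum; apply: eq_bigr => j _.
by rewrite enum_rankK col_column_matrix linearZ /= enum_rankK.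
Qed.

(** The columns span, so the rows of [H] are independent and the syndrome map is onto; its kernel is
    the code, of codimension [r]. *)
Lemma covering_code_exists (R : nat) :
    spans_within R -> (forall R', spans_within R' -> (R <= R')%N) ->
  exists2 C : {vspace 'rV[F]_#|I|}, linear_code r C & has_covering_radius C R.
Proof.
move=> cover_R min_R.
have H_free : row_free H.
  apply: inj_row_free => y yH; apply/rowP => k; rewrite [RHS]mxE.
  have yc i : y *m (c i)^T = 0.
    rewrite -(enum_rankK i) -col_column_matrix -[RHS](mul0mx _ (delta_mx (enum_rank i) 0)) -yH.
    by rewrite colE mulmxA.
  have [J [a [_ Ds]]] := cover_R (delta_mx 0 k).
  have : y *m (delta_mx 0 k : 'rV_r)^T = 0.
    rewrite Ds linear_sum mulmx_sumr big1 // => i _.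
    by rewrite linearZ -scalemxAr yc scaler0.
  by rewrite trmx_delta -colE => /matrixP/(_ 0 0); rewrite !mxE.
pose f : {linear 'rV[F]_#|I| -> 'rV[F]_r} := mulmxr H^T.
pose C := lker (linfun f).
have CE x : (x \in C) = (H *m x^T == 0).
  by rewrite memv_ker lfunE /= -[H in RHS]trmxK -trmx_mul trmx_eq0.
exists C; last first.
  exists r, H; split=> //; first exact/covered_by_columnsP.
  by move=> R' /covered_by_columnsP/min_R.
have le_rn : (r <= #|I|)%N by rewrite -(eqP H_free) rank_leq_col.
split=> //.
have := limg_ker_dim (linfun f) fullv; rewrite capfv -/C.
have -> : limg (linfun f) = fullv.
  apply/vspaceP=> v; rewrite memvf; apply/memv_imgP.
  have /row_freeP[B HB] := H_free; exists (v *m B^T); first exact: memvf.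
  by rewrite lfunE /= -mulmxA -trmx_mul HB trmx1 mulmx1.
by rewrite !dimvf /dim /= !mul1n => E; rewrite -[X in (X - r)%N]E addnK.
Qed.

End CodeOfColumns.

Lemma exact_cover_spans_within (F : fieldType) (I : finType) (r R : nat)
    (c : I -> 'rV[F]_r) :
  (forall s, exact_comb c R s) -> spans_within c R.
Proof.
move=> c_exact s; have [a Da ->] := c_exact s.
exists [set i | a i != 0], a; split; first by rewrite Da.
rewrite [LHS](bigID (mem [set i | a i != 0])) /= [X in _ + X]big1 ?addr0 //.
by move=> i; rewrite inE negbK => /eqP->; rewrite scale0r.
Qed.

(** * The length and the final assembly *)

(** The right-hand side counts the points: N vertices, Q - 1 inner points on each of
    [4 * N + 'C(N, 2)] edges, Q + 1 points on each of four lines. *)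
Lemma n1_simplex (N Q : nat) : (0 < Q)%N ->
  n1 (N + 3) Q = (N + (4 * N + 'C(N, 2)) * (Q - 1) + 4 * (Q + 1))%N.
Proof.
move=> Q_gt0; rewrite /n1.
have -> : (((N + 3) * (N + 3 + 1)) %/ 2 = 'C(N + 4, 2))%N.
  by rewrite bin2 -divn2 mulnC !addnS addn0.
have -> : ('C(N + 4, 2) = 'C(N, 2) + 4 * N + 6)%N.
  by rewrite addn4 !binS !bin0 !bin1; lia.
nia.
Qed.

(** This lets the points receive distinct labels in F. The induction starts from 8 Q + 1 <= 27 Q <=
    Q^4. *)
Lemma n1_leq (N Q : nat) : (0 < N)%N -> (2 < Q)%N -> (n1 (N + 3) Q <= Q ^ (N + 3))%N.
Proof.
move=> N_gt0 Q_gt2; rewrite n1_simplex ?(ltn_trans _ Q_gt2) //.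
elim: N N_gt0 => // -[_ _|N /(_ isT) IH _].
  rewrite -[(1 + 3)%N]/(2 + 2)%N expnD -mulnn bin_small // addn0.
  have QQ : (3 * Q <= Q * Q)%N by rewrite leq_mul2r Q_gt2 orbT.
  have := leq_mul (leq_trans (leq_mul (leqnn 3) Q_gt2) QQ) QQ; lia.
rewrite addSn expnS binS bin1.
move: ('C(_, 2)) (Q ^ _)%N IH => P E IH; nia.
Qed.

Theorem theorem22 (R q' q : nat) (F : finFieldType) (t0 : int)
  (hR : (4 <= R)%N) (hq'3 : (3 <= q')%N) (hq' : prime_power q')
  (hq : q = (q' ^ R)%N) (hF : #|F| = q)
  (ht0 : (n1 R q')%:R <= (q%:R : rat) ^ (t0 - 1)) :
  forall t r : nat, r = (R * t + 1)%N -> t = 1%N \/ t0 <= t%:Z ->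
  exists n : nat,
    [/\ (4 <= q')%N -> n = (n1 R q' * q ^ ((r - (R + 1)) %/ R))%N,
        q' = 3%N -> exists2 w : nat, w = 0%N \/ w = 1%N &
          n = (n1 R q' * q ^ ((r - (R + 1)) %/ R)
               + w * ((q ^ ((r - (R + 1)) %/ R) - 1) %/ (q - 1)))%N
      & exists2 C : {vspace 'rV[F]_n}, linear_code r C & has_covering_radius C R].
Proof.
move=> t r Dr t_cond.
have t_gt0 : (0 < t)%N.
  (* For t = 0, [t0 <= 0] would bound q^(t0 - 1) by 1, which is below [n1]. *)
  case: t_cond => [->//|le_t0]; rewrite lt0n; apply/eqP=> t_eq0.
  have : (n1 R q')%:R <= (1 : rat).
    apply: (le_trans ht0); rewrite -(expr0z (q%:R : rat)).
    by apply: ler_weXz2l; [rewrite ler1n hq expn_gt0; lia|lia].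
  by rewrite (ler_nat _ _ 1) /n1 !addnS.
case: t t_gt0 Dr {t_cond} => // m _ Dr.
have [N N_gt0 DR] : exists2 N, (0 < N)%N & R = (N + 3)%N by exists (R - 3)%N; lia.
have Er : r = (N + (2 + 2) + R * m)%N by rewrite Dr DR; lia.
have -> : ((r - (R + 1)) %/ R = m)%N.
  rewrite Dr mulnS (_ : _ - _ = R * m)%N ?mulKn //; lia.
have [K [iota oK]] := subfield_exists hq' (etrans hF hq).
have oF : #|F| = (#|K| ^ (N + 3))%N by rewrite hF hq oK DR.
have K_gt2 : (2 < #|K|)%N by rewrite oK.
have F_gt3 : (3 < #|F|)%N.
  rewrite oF; apply: (@leq_trans (3 ^ 3)) => //.
  by rewrite (@leq_trans (3 ^ (N + 3))) ?leq_pexp2l ?leq_addl ?leq_exp2r ?addn3.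
have [M M_no_eig] := exists_no_eigenvector K.
pose h k := map_mx iota (@simplex_pt K M N k).
set J := (X in X -> _) in h.
have oJ : #|{: J}| = n1 R q'.
  rewrite DR n1_simplex; last by lia.
  rewrite !card_sum card_ord card_prod card_edge !card_option oK card_sig (cardC1 (0 : K)) oK.
  lia.
have [b b_inj] : exists b : J -> F, injective b.
  by apply: exists_injection; rewrite oJ hF hq DR n1_leq.
pose c := concat_col R h b (id : 'rV[F]_m -> _).
have oI : #|{: J * 'rV[F]_m}| = (n1 R q' * q ^ m)%N.
  by rewrite card_prod oJ card_mx hF mul1n.
exists #|{: J * 'rV[F]_m}|; split=> [//|_|].
  by exists 0%N; [left|rewrite mul0n addn0].
rewrite {}Er; apply: (covering_code_exists (c := c)).
  apply: exact_cover_spans_within; apply: concat_exact_cover => // [v|u].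
    by exists v.
  by rewrite DR; apply: simplex_exact_cover.
move=> R' c_R'; rewrite DR.
(* The syndrome (u, 0) needs R columns: on the first R + 1 coordinates, a combination of columns is
   an F-combination of vectors over K equal to [u]. *)
have [|u u_rank] := @exists_rank_vector F K iota (N + 3) oF (N + (2 + 2)); first by lia.
have [I [a [le_IR' Du]]] := c_R' (row_mx u 0).
apply: leq_trans le_IR'; apply: (u_rank _ (fun k => simplex_pt M k.1) I a).
rewrite -[LHS](row_mxKl u (0 : 'rV_(R * m))) Du linear_sum; apply: eq_bigr => k _.
by rewrite linearZ /= row_mxKl.
Qed.
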